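(* Let $a\in\mathbb{Z}^n$ have positive components, let $u$ be a vector each of whose components is a positive integer or $+\infty$, let $0<\beta_1\le\beta_2<au$, and consider $$\text{(KP)}\qquad \beta_1\le ax\le\beta_2,\quad 0\le x\le u,\quad x\in\mathbb{Z}^n.$$ Let $p\in\mathbb{Z}^n$ have positive components and let $k$ be an integer such that the infeasibility of (KP) is proven by $px\le k\,\vee\,px\ge k+1$. 1. If $u=e$ (the vector of all ones), then ordinary branch-and-bound needs at least $2^{\ell(p,k)}$ nodes to prove the infeasibility of (KP), independently of the sequence in which the branching variables are chosen. 2. If $u_i=+\infty$ for all $i$, then ordinary branch-and-bound needs at least $$\binom{\lfloor k/\|p\|_\infty\rfloor+n-1}{n-1}$$ nodes to prove the infeasibility of (KP), independently of the sequence in which the branching variables are chosen.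
   Context: $px$, $ax$, $au$ denote inner products; $au=+\infty$ if some $u_i=+\infty$. The LP relaxation of an integer program is obtained by dropping integrality. Split disjunction: the infeasibility of an integer program is proven by $px \le k \vee px \ge k+1$ if both $\{x : px \le k\}$ and $\{x : px \ge k+1\}$ have empty intersection with the feasible set of its LP relaxation. $\ell(p,k)$: with $N=\{1,\dots,n\}$ and $p(S)=\sum_{i\in S}p_i$ for $S \subseteq N$, $$\ell(p,k)=\max\{\ell : p(F)\le k \text{ and } p(N\setminus F)\ge k+1 \text{ for all } F\subseteq N \text{ with } |F|=\ell\}.$$ Ordinary branch-and-bound means branch-and-bound branching on individual variables. A node is identified by a node-fixing $(\bar x,F)$: a set $F\subseteq N$ of fixed variables and integers $\bar x_i$, $0\le \bar x_i\le u_i$ $(i\in F)$. Variables are chosen for branching in some order $x_{j_1},\dots,x_{j_n}$; the root has $F=\emptyset$; a node with $F=\{j_1,\dots,j_t\}$, $t<n$, generates one node for each integer value that $x_{j_{t+1}}$ can take such that the LP relaxation of (KP) with the resulting fixings is feasible. A node is pruned only when its LP relaxation is infeasible (such nodes are not counted). The number of nodes is the total number of nodes so generated. *)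

(* Defs.v *)
From mathcomp Require Import all_boot all_order all_algebra perm.
From mathcomp Require Import classical_sets cardinality reals constructive_ereal.

Set Implicit Arguments.
Unset Strict Implicit.
Unset Printing Implicit Defensive.

Import Order.TTheory GRing.Theory Num.Theory.
Local Open Scope ring_scope.
Local Open Scope classical_set_scope.

Definition dot (R : realType) (n : nat) (c : 'rV[int]_n) (x : 'rV[R]_n) : R :=
  \sum_(i < n) (c 0 i)%:~R * x 0 i.

(* For positive a, this is +oo as soon as some component of u is. *)
Definition edot (n : nat) (a : 'rV[int]_n) (u : 'rV[\bar int]_n) : \bar int :=
  (\sum_(i < n) (a 0%R i)%:E * u 0%R i)%E.

Definition toR (R : realType) (v : \bar int) : \bar R :=
  er_map (fun z : int => z%:~R) v.

(* Feasible set of the LP relaxation of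
   b1 <= a x <= b2, 0 <= x <= u, x integer. *)
Definition kp_lp (R : realType) (n : nat) (a : 'rV[int]_n) (u : 'rV[\bar int]_n)
    (b1 b2 : R) : set 'rV[R]_n :=
  [set x | b1 <= dot a x <= b2 /\
           forall i, 0 <= x 0 i /\ ((x 0%R i)%:E <= toR R (u 0%R i))%E].

Definition infeasibility_proven_by (R : realType) (n : nat) (lp : set 'rV[R]_n)
    (p : 'rV[int]_n) (k : int) : Prop :=
  [set x | dot p x <= k%:~R] `&` lp = set0 /\
  [set x | dot p x >= (k + 1)%:~R] `&` lp = set0.

Definition weight (n : nat) (p : 'rV[int]_n) (S : {set 'I_n}) : int :=
  \sum_(i in S) p 0 i.

(* The maximum runs over 0 <= l <= n: for l > n there is no F with #|F| = l
   and the condition would hold vacuously. *)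
Definition ell (n : nat) (p : 'rV[int]_n) (k : int) : nat :=
  \max_(l < n.+1 | [forall F : {set 'I_n}, (#|F| == l) ==>
      (weight p F <= k) && (weight p (~: F) >= k + 1)]) l.

Definition norm_infty (n : nat) (p : 'rV[int]_n) : int :=
  \big[Num.max/0]_(i < n) `|p 0 i|.

(* The pair (x, F) is encoded as one partial map: it sends i to Some x_i when
   i is in F and to None otherwise. *)
Definition node_fixing (n : nat) : Type := {ffun 'I_n -> option int}.

Definition root_node (n : nat) : node_fixing n := [ffun=> None].

Definition fixed_vars (n : nat) (d : node_fixing n) : {set 'I_n} :=
  [set i | isSome (d i)].

Definition fix_var (n : nat) (d : node_fixing n) (j : 'I_n) (v : int) :
    node_fixing n :=
  [ffun i => if i == j then Some v else d i].

Definition lp_with_fixings (R : realType) (n : nat) (lp : set 'rV[R]_n)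
    (d : node_fixing n) : set 'rV[R]_n :=
  [set x | lp x /\ forall i v, d i = Some v -> x 0 i = v%:~R].

(* With indices starting at 0, s t is the variable branched on at depth t.
   The root is a node of the tree and is counted. *)
Inductive bb_node (R : realType) (n : nat) (a : 'rV[int]_n)
    (u : 'rV[\bar int]_n) (b1 b2 : R) (s : 'S_n) : node_fixing n -> Prop :=
| bb_root : bb_node a u b1 b2 s (root_node n)
| bb_branch (d : node_fixing n) (t : 'I_n) (v : int) :
    bb_node a u b1 b2 s d ->
    fixed_vars d = [set s i | i : 'I_n & (i < t)%N]%SET ->
    0 <= v -> (v%:E <= u 0%R (s t))%E ->
    lp_with_fixings (kp_lp a u b1 b2) (fix_var d (s t) v) !=set0 ->
    bb_node a u b1 b2 s (fix_var d (s t) v).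

Definition bb_tree (R : realType) (n : nat) (a : 'rV[int]_n)
    (u : 'rV[\bar int]_n) (b1 b2 : R) (s : 'S_n) : set (node_fixing n) :=
  [set d | bb_node a u b1 b2 s d].

(* Main.v *)
Require Import Defs.
From mathcomp Require Import all_boot all_order all_algebra perm.
From mathcomp Require Import classical_sets cardinality reals constructive_ereal.
From mathcomp Require Import ring lra.

(** A box point z with p z <= k satisfies a z < b1: otherwise shrinking z
    towards 0 would reach a x = b1 while keeping p x <= k, which produces an LP
    solution on the low side of the split.  Symmetrically a box point y with
    p y >= k + 1 satisfies a y > b2: since b2 < a u, growing y inside the box
    would otherwise reach a x = b2 while keeping p x >= k + 1.  (These are
    [split_low] and [split_high].)

    Consequently a node survives as soon as its fixings can be completed, inside
    the box, both to a point z with p z <= k and to a larger point y with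
    p y >= k + 1: on the segment from z to y, where all fixed variables are
    constant, a x moves continuously from below b1 to above b2, hence equals b1
    somewhere ([node_lp_feasible]).  Both conditions are inherited by the
    ancestors of the node, so the node really is generated
    ([branch_node_reached]).

    It remains to count the nodes of one suitable depth that have such
    completions.  Completing by zeros is the best choice for z.
    - For binary variables and depth l = ell p k, completing by ones gives y.
      The definition of ell quantifies over all sets of l variables, hence covers
      those fixed at depth l in any branching order: all 2 ^ l nodes qualify.
    - For unbounded variables and depth n - 1, the remaining variable can be made
      as large as y requires, so only p z <= k matters; it holds whenever the
      fixed values sum to at most N = floor (k / norm_infty p), and there are
      'C(N + n - 1, n - 1) tuples of n - 1 natural numbers with this property. *)

Set Implicit Arguments.
Unset Strict Implicit.
Unset Printing Implicit Defensive.

Import Order.TTheory GRing.Theory Num.Theory.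
Local Open Scope ring_scope.
Local Open Scope classical_set_scope.
Local Open Scope card_scope.

(** * Counting *)

Lemma uniq_card_ge (U : eqType) (l : seq U) (A : set U) :
  uniq l -> (forall x, x \in l -> A x) -> `I_(size l) #<= A.
Proof.
case: l => [|x0 l] ul lA; first by rewrite II0 card_ge0.
apply/card_subP; exists (nth x0 (x0 :: l) @` `I_(size (x0 :: l))).
  apply: inj_card_eq => i j; rewrite !inE /= => il jl /eqP.
  by rewrite nth_uniq // => /eqP.
by move=> _ /= [i il <-]; apply/lA/mem_nth.
Qed.

(** * Points of the box *)

Lemma dotD (R : realType) n (c : 'rV[int]_n) (x y : 'rV[R]_n) :
  dot c (x + y) = dot c x + dot c y.
Proof.
by rewrite /dot -big_split; apply: eq_bigr => i _ /=; rewrite mxE mulrDr.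
Qed.

Lemma dotZ (R : realType) n (c : 'rV[int]_n) l (x : 'rV[R]_n) :
  dot c (l *: x) = l * dot c x.
Proof.
by rewrite /dot mulr_sumr; apply: eq_bigr => i _; rewrite mxE mulrCA.
Qed.

Lemma dot0 (R : realType) n (c : 'rV[int]_n) : dot c (0 : 'rV[R]_n) = 0.
Proof. by rewrite -(scale0r 0) dotZ mul0r. Qed.

Lemma ler_dot (R : realType) n (c : 'rV[int]_n) (x y : 'rV[R]_n) :
  (forall i, 0 < c 0 i) -> (forall i, x 0 i <= y 0 i) -> dot c x <= dot c y.
Proof.
move=> c0 xy; apply: ler_sum => i _.
by rewrite ler_wpM2l // ler0z ltW.
Qed.

Lemma dot_delta (R : realType) n (c : 'rV[int]_n) j :
  dot c (delta_mx 0 j) = (c 0 j)%:~R :> R.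
Proof.
rewrite /dot (bigD1 j) //= big1 ?mxE ?eqxx ?mulr1 ?addr0 // => i ij.
by rewrite mxE eqxx (negPf ij) mulr0.
Qed.

Definition segment (R : realType) n (y z : 'rV[R]_n) (l : R) : 'rV[R]_n :=
  l *: z + (1 - l) *: y.

Lemma segment_le (R : realType) n (y z : 'rV[R]_n) (l : R) i :
  0 <= l <= 1 -> y 0 i <= z 0 i ->
  y 0 i <= segment y z l 0 i <= z 0 i.
Proof. by move=> l01 yz; rewrite !mxE; apply/andP; split; nra. Qed.

Lemma segment_dot_eq (R : realType) n (a : 'rV[int]_n) (y z : 'rV[R]_n) c :
  dot a y <= c <= dot a z ->
  exists2 l, 0 <= l <= 1 & dot a (segment y z l) = c.
Proof.
move=> /andP[ayc caz]; have [ayz|ayz] := eqVneq (dot a y) (dot a z).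
  exists 0; first by rewrite lexx ler01.
  by rewrite dotD !dotZ; lra.
have d_gt0 : 0 < dot a z - dot a y by rewrite subr_gt0 lt_neqAle ayz; lra.
exists ((c - dot a y) / (dot a z - dot a y)).
  by rewrite divr_ge0 ?ler_pdivrMr //=; lra.
by rewrite dotD !dotZ; field; rewrite gt_eqF.
Qed.

Definition box (R : realType) n (u : 'rV[\bar int]_n) : set 'rV[R]_n :=
  [set x | forall i, 0 <= x 0 i /\ ((x 0%R i)%:E <= toR R (u 0%R i))%E].

Lemma box0 (R : realType) n (u : 'rV[\bar int]_n) :
  (forall i, (0 < u 0%R i)%E) -> box u (0 : 'rV[R]_n).
Proof.
move=> u_gt0 i; rewrite mxE; split=> //; have := u_gt0 i.
case: (u 0%R i) => [r| |] // r_gt0; last by rewrite leey.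
by rewrite lee_fin ler0z ltW // -lte_fin.
Qed.

Lemma box_between (R : realType) n (u : 'rV[\bar int]_n) (x y : 'rV[R]_n) :
  box u y -> (forall i, 0 <= x 0 i <= y 0 i) -> box u x.
Proof.
move=> uy xy i; have [_ yi] := uy i; have /andP[x0 xyi] := xy i; split=> //.
by apply: le_trans yi; rewrite lee_fin.
Qed.

(** If some u i is infinite, raising y by |b| in that direction suffices because
    a i >= 1; otherwise u itself is the point. *)
Lemma exists_above_dot_ge (R : realType) n (a : 'rV[int]_n)
    (u : 'rV[\bar int]_n) (b : R) (y : 'rV[R]_n) :
  (forall i, 0 < a 0 i) -> (b%:E < toR R (edot a u))%E -> box u y ->
  exists2 z, box u z & (forall i, y 0 i <= z 0 i) /\ b <= dot a z.
Proof.
move=> a0 bau uy.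
have [/existsP[j /eqP uj]|/existsPn ufin] := boolP [exists j, u 0%R j == +oo%E].
  exists (y + `|b| *: delta_mx 0 j).
    move=> i; rewrite !mxE eqxx /=; have [y0 yu] := uy i.
    split; first by rewrite addr_ge0 // mulr_ge0.
    by have [->|_] := eqVneq i j; rewrite ?uj ?leey // mulr0 addr0.
  split=> [i|]; first by rewrite !mxE lerDl mulr_ge0.
  have y0 : 0 <= dot a y.
    by rewrite -(dot0 R a); apply: ler_dot => // i; rewrite mxE; case: (uy i).
  have aj1 : 1 <= (a 0 j)%:~R :> R by rewrite ler1z -gtz0_ge1.
  have := ler_norm b; have := normr_ge0 b.
  by rewrite dotD dotZ dot_delta; nra.
have uE i : u 0%R i = (fine (u 0%R i))%:E.
  by have := ufin i; have := uy i; case: (u 0%R i) => //= -[_].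
exists (\row_i (fine (u 0%R i))%:~R).
  move=> i; rewrite mxE; have [y0] := uy i.
  by rewrite uE /= !lee_fin => /(le_trans y0).
split=> [i|].
  by have [_] := uy i; rewrite uE lee_fin mxE.
move: bau; rewrite /edot; under eq_bigr do rewrite uE -EFinM.
rewrite sumEFin lte_fin rmorph_sum => /ltW /le_trans; apply.
by rewrite /dot; apply: ler_sum => i _; rewrite mxE rmorphM.
Qed.

(** * The depth ell p k *)

(** The alternative ell p k = 0 also covers a maximum over no admissible depth. *)
Lemma ell_spec n (p : 'rV[int]_n) k :
  ell p k = 0%N \/
  (ell p k <= n)%N /\ forall F : {set 'I_n}, #|F| = ell p k ->
    (weight p F <= k) && (weight p (~: F) >= k + 1).
Proof.
pose P := [pred l : 'I_n.+1 | [forall F : {set 'I_n}, (#|F| == l) ==>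
    (weight p F <= k) && (weight p (~: F) >= k + 1)]].
rewrite (_ : ell p k = \max_(l in P) l)%N //.
have [/card0_eq P0|] := posnP #|P|; first by left; rewrite big_pred0.
case/(eq_bigmax_cond (fun l : 'I_n.+1 => nat_of_ord l)) => l Pl E; right.
rewrite E; split=> [|F /eqP Fl]; first by rewrite -ltnS.
by move: Pl; rewrite inE => /forallP/(_ F)/implyP; apply.
Qed.

(** * Feasible nodes *)

Section Knapsack.
Context (R : realType) (n : nat) (a p : 'rV[int]_n) (u : 'rV[\bar int]_n).
Context (b1 b2 : R) (k : int).
Hypotheses (a_gt0 : forall i, 0 < a 0 i) (p_gt0 : forall i, 0 < p 0 i).
Hypotheses (b1_gt0 : 0 < b1) (b12 : b1 <= b2).
Hypothesis (b2_lt : (b2%:E < toR R (edot a u))%E).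
Hypothesis (pk : infeasibility_proven_by (kp_lp a u b1 b2) p k).

(** Shrink z towards 0 until a x = b1. *)
Lemma split_low (z : 'rV[R]_n) : box u z -> dot p z <= k%:~R -> dot a z < b1.
Proof.
move=> uz pz; rewrite ltNge; apply/negP => az.
have [|l l01 al] := @segment_dot_eq R n a 0 z b1; first by rewrite dot0 ltW.
have le_l i : 0 <= segment 0 z l 0 i <= z 0 i.
  have := @segment_le R n 0 z l i l01; rewrite [(0 : 'rV_n) _ _]mxE.
  by apply; case: (uz i).
case: pk => + _; rewrite -subset0 => /(_ (segment 0 z l)).
apply; split; last first.
  by split; [rewrite al lexx | exact: box_between uz le_l].
by apply: le_trans pz; apply: ler_dot => // i; case/andP: (le_l i).
Qed.

(** Grow y towards a box point beyond b2 until a x = b2. *)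
Lemma split_high (y : 'rV[R]_n) :
  box u y -> (k + 1)%:~R <= dot p y -> b2 < dot a y.
Proof.
move=> uy py; rewrite ltNge; apply/negP => ay.
have [z uz [yz az]] := exists_above_dot_ge a_gt0 b2_lt uy.
have [|l l01 al] := @segment_dot_eq R n a y z b2; first by rewrite ay.
have le_l i := segment_le l01 (yz i).
case: pk => _; rewrite -subset0 => /(_ (segment y z l)); apply; split.
  by apply: le_trans py _; apply: ler_dot => // i; case/andP: (le_l i).
split; first by rewrite al b12 lexx.
apply: box_between uz _ => i; case/andP: (le_l i) => yl ->.
by rewrite andbT (le_trans _ yl) //; case: (uy i).
Qed.

(** Otherwise the origin would lie on the high side of the split. *)
Lemma split_index_ge0 : (forall i, (0 < u 0%R i)%E) -> 0 <= k.
Proof.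
move=> u_gt0; rewrite leNgt; apply/negP => k_lt0.
have /split_high := @box0 R n u u_gt0.
rewrite !dot0 lerz0 lezD1 k_lt0 => /(_ isT).
by apply/negP; rewrite -leNgt (le_trans (ltW b1_gt0)).
Qed.

(** The fixed variables agree at z and y, hence along the whole segment, on
    which a x takes the value b1. *)
Lemma node_lp_feasible (d : node_fixing n) (z y : 'rV[R]_n) :
  box u y -> (forall i, 0 <= z 0 i <= y 0 i) ->
  (forall i v, d i = Some v -> z 0 i = v%:~R /\ y 0 i = v%:~R) ->
  dot p z <= k%:~R -> (k + 1)%:~R <= dot p y ->
  lp_with_fixings (kp_lp a u b1 b2) d !=set0.
Proof.
move=> uy zy dzy pz py.
have uz := box_between uy zy.
have az := split_low uz pz; have ay := split_high uy py.
have [|l l01 al] := @segment_dot_eq R n a z y b1.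
  by rewrite (ltW az) (le_trans b12 (ltW ay)).
exists (segment z y l); split; last first.
  by move=> i v /dzy[zi yi]; rewrite !mxE zi yi; lra.
split; first by rewrite al lexx.
apply: box_between uy _ => i; case/andP: (zy i) => z0 zyi.
by have /andP[zl ->] := segment_le l01 zyi; rewrite (le_trans z0).
Qed.


(** * Generated nodes *)

Variable s : 'S_n.

(** A node is the word of the values chosen along the path from the root, so that
    generating a child appends a letter; the variable i is the (s^-1 i)-th one to
    be branched on. *)
Definition branch_node (w : seq nat) : node_fixing n :=
  [ffun i => omap Posz (onth w (s^-1%g i))].

Definition completion (c : nat) (w : seq nat) : 'rV[R]_n :=
  \row_i (nth c w (s^-1%g i))%:R.

Lemma branch_node_inj w w' : (size w <= n)%N -> (size w' <= n)%N ->
  branch_node w = branch_node w' -> w = w'.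
Proof.
move=> wn w'n /ffunP e; apply: eq_from_onth_le => i i_lt.
have ltin : (i < n)%N by apply: leq_trans i_lt _; rewrite geq_max wn.
have := e (s (Ordinal ltin)); rewrite !ffunE permK /=.
by case: (onth w i) => [x|]; case: (onth w' i) => [y|] // [->].
Qed.

Lemma branch_node_nil : branch_node [::] = root_node n.
Proof. by apply/ffunP => i; rewrite !ffunE onth0n. Qed.

Lemma branch_node_rcons w v (ltwn : (size w < n)%N) :
  branch_node (rcons w v) = fix_var (branch_node w) (s (Ordinal ltwn)) v.
Proof.
apply/ffunP => i; rewrite !ffunE -(can2_eq (permKV s) (permK s)) -val_eqE /=.
rewrite -cats1 onth_cat; case: ltngtP => //= [lt|->]; last by rewrite subnn.
by rewrite !onth_default //= ?subn_gt0 // ltnW.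
Qed.

Lemma fixed_vars_branch_node w :
  fixed_vars (branch_node w) = [set s i | i : 'I_n & (i < size w)%N]%SET.
Proof.
apply/setP => i; rewrite inE ffunE.
have -> : isSome (omap Posz (onth w (s^-1%g i))) = (s^-1%g i < size w)%N.
  by rewrite -onthTE; case: onth.
apply/idP/imsetP => [lt|[j + ->]]; last by rewrite inE permK.
by exists (s^-1%g i); rewrite ?inE ?permKV.
Qed.

Lemma completion_agrees c w i v :
  branch_node w i = Some v -> completion c w 0 i = v%:~R.
Proof.
rewrite ffunE mxE; case e: onth => [m|] //= [<-].
by rewrite (onth_nth c _ _ _ e) pmulrn.
Qed.

(** By induction on the depth: a single y serves all ancestors, since it agrees
    with their fixings too, and dropping the last letter can only decrease the
    value of p at the completion by zeros. *)
Lemma branch_node_reached w (y : 'rV[R]_n) :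
  (size w <= n)%N -> box u y ->
  (forall i v, branch_node w i = Some v -> y 0 i = v%:~R) ->
  dot p (completion 0 w) <= k%:~R -> (k + 1)%:~R <= dot p y ->
  bb_node a u b1 b2 s (branch_node w).
Proof.
move=> + uy + + py; elim/last_ind: w => [|w v IH].
  by rewrite branch_node_nil => *; exact: bb_root.
rewrite size_rcons => ltwn wy pz.
have yv : y 0 (s (Ordinal ltwn)) = v%:R.
  by rewrite (wy _ v) // branch_node_rcons ffunE eqxx.
have sub_y i m : branch_node w i = Some m -> y 0 i = m%:~R.
  move=> wi; apply: wy; rewrite (branch_node_rcons _ ltwn) ffunE.
  case: eqP => // iE.
  by move: wi; rewrite ffunE iE permK onth_default.
have lp_y : lp_with_fixings (kp_lp a u b1 b2) (branch_node (rcons w v)) !=set0.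
  apply: (node_lp_feasible uy _ _ pz py) => i; last first.
    by move=> m wi; rewrite (completion_agrees _ wi) (wy _ _ wi).
  rewrite mxE ler0n /=; case e: (onth (rcons w v) (s^-1%g i)) => [m|].
    by rewrite (wy i m) ?ffunE ?e // (onth_nth 0%N _ _ _ e) pmulrn.
  rewrite nth_default; first by case: (uy i).
  by rewrite -onthNE e.
rewrite (branch_node_rcons _ ltwn) in lp_y *; apply: bb_branch => //.
- apply: IH => //; first exact: ltnW.
  apply: le_trans pz; apply: ler_dot => // i; rewrite !mxE ler_nat nth_rcons.
  by case: ltnP => // lt; rewrite nth_default.
- exact: fixed_vars_branch_node.
- have [_] := uy (s (Ordinal ltwn)); rewrite yv.
  case: (u 0%R _) => [r| |] //=.
  by rewrite !lee_fin pmulrn ler_int.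
Qed.

Lemma branch_node_completion_reached c w :
  (size w <= n)%N -> box u (completion c w) ->
  dot p (completion 0 w) <= k%:~R -> (k + 1)%:~R <= dot p (completion c w) ->
  bb_node a u b1 b2 s (branch_node w).
Proof.
by move=> wn uc; apply: branch_node_reached => // i v; exact: completion_agrees.
Qed.

Lemma branch_nodes_card_ge (T : finType) (P : {pred T}) (word : T -> seq nat) :
  injective word ->
  (forall t, t \in P -> (size (word t) <= n)%N) ->
  (forall t, t \in P -> bb_node a u b1 b2 s (branch_node (word t))) ->
  `I_(#|P|) #<= bb_tree a u b1 b2 s.
Proof.
move=> word_inj word_size word_node.
rewrite cardE -(size_map (branch_node \o word)); apply: uniq_card_ge.
  rewrite map_inj_in_uniq ?enum_uniq // => t t'; rewrite !mem_enum => Pt Pt'.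
  by move/branch_node_inj => e; apply: word_inj; apply: e; apply: word_size.
by move=> _ /mapP[t + ->]; rewrite mem_enum; exact: word_node.
Qed.

Lemma sum_nth_branch w : (size w <= n)%N ->
  (\sum_i nth 0 w (s^-1%g i) = sumn w)%N.
Proof.
move=> wn; rewrite (reindex_inj (@perm_inj _ s)) /=.
under eq_bigr do rewrite permK.
rewrite -(big_mkord xpredT (nth 0%N w)) (big_cat_nat _ wn) //=.
rewrite [X in (_ + X)%N]big_nat_cond [X in (_ + X)%N]big1 ?addn0.
  by rewrite sumnE [RHS](big_nth 0%N).
by move=> i /andP[/andP[lt _] _]; rewrite nth_default.
Qed.

Lemma le_norm_infty i : p 0 i <= norm_infty p.
Proof.
by apply: le_trans (ler_norm _) _; exact: (le_bigmax 0 (fun i => `|p 0 i|)).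
Qed.

Lemma dot_completion0_le w : (size w <= n)%N ->
  dot p (completion 0 w) <= (norm_infty p * (sumn w)%:Z)%:~R.
Proof.
move=> wn; rewrite -(sum_nth_branch wn).
rewrite rmorphM /= -pmulrn natr_sum mulr_sumr; apply: ler_sum => i _.
by rewrite mxE ler_wpM2r // ler_int le_norm_infty.
Qed.

Lemma dot_completion_ge c w (i : 'I_n) : (size w <= s^-1%g i)%N ->
  c%:R <= dot p (completion c w).
Proof.
move=> wi; rewrite /dot (bigD1 i) //= mxE nth_default //.
have p1 : 1 <= (p 0 i)%:~R :> R by rewrite ler1z -gtz0_ge1.
apply: (@le_trans _ _ ((p 0 i)%:~R * c%:R)); first by rewrite ler_peMl.
by rewrite lerDl; apply: sumr_ge0 => j _; rewrite mxE mulr_ge0 // ler0z ltW.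
Qed.

Lemma dot_indicator (F : {set 'I_n}) :
  dot p (\row_i (i \in F)%:R : 'rV[R]_n) = (weight p F)%:~R.
Proof.
rewrite /dot /weight rmorph_sum big_mkcond [in RHS]big_mkcond.
by apply: eq_bigr => i _ /=; rewrite mxE; case: ifP; rewrite ?mulr1 ?mulr0.
Qed.

(** * The two lower bounds *)

Lemma card_first_branched l : (l <= n)%N ->
  #|[set s i | i : 'I_n & (i < l)%N]%SET| = l.
Proof.
move=> ln; rewrite card_imset; last exact: perm_inj.
by rewrite -sum1_card; under eq_bigl do rewrite inE;
   rewrite (big_ord_narrow ln) big_const_ord iter_addn_0 mul1n.
Qed.

Lemma binary_nodes_card_ge :
  u = const_mx 1%:E -> `I_(2 ^ ell p k) #<= bb_tree a u b1 b2 s.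
Proof.
move=> uE; have {1}-> : (2 ^ ell p k = #|{: (ell p k).-tuple bool}|)%N.
  by rewrite card_tuple card_bool.
pose word (t : (ell p k).-tuple bool) := map nat_of_bool t.
apply: (@branch_nodes_card_ge _ _ word) => [t t' /inj_map e|t _|t _].
- by apply/val_inj/e => -[] [].
- by rewrite size_map size_tuple; case: (ell_spec p k) => [->|[]].
case: (ell_spec p k) => [l0|[ln lF]].
  have -> : word t = [::] by apply: size0nil; rewrite size_map size_tuple.
  by rewrite branch_node_nil; exact: bb_root.
have word_size : size (word t) = ell p k by rewrite size_map size_tuple.
have word_le1 c i : (c <= 1)%N -> (nth c (word t) i <= 1)%N.
  move=> c1; have [lt|le] := ltnP i (size (word t)); last by rewrite nth_default.
  by have /mapP[b _ ->] := mem_nth c lt; case: b.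
have mem_fixed i :
    i \in [set s j | j : 'I_n & (j < ell p k)%N]%SET = (s^-1%g i < ell p k)%N.
  by rewrite -word_size -fixed_vars_branch_node inE ffunE -onthTE; case: onth.
have /andP[] := lF _ (card_first_branched ln).
rewrite -!(ler_int R) -!dot_indicator; set F := [set _ | _ in _]%SET => pF pNF.
apply: (@branch_node_completion_reached 1); first by rewrite word_size.
- by move=> i; rewrite uE !mxE /= lee_fin ler0n ler_nat word_le1.
- apply: le_trans pF; apply: ler_dot => // i; rewrite !mxE ler_nat mem_fixed.
  by case: ltnP => lt; rewrite ?word_le1 // nth_default // word_size.
- apply: (le_trans pNF); apply: ler_dot => // i.
  rewrite !mxE ler_nat inE mem_fixed.
  by case: ltnP => //= le; rewrite nth_default // word_size.
Qed.

Lemma unbounded_nodes_card_ge :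
  (0 < n)%N -> 0 <= k -> u = const_mx +oo%E ->
  `I_('C(`|(k %/ norm_infty p)%Z| + n - 1, n - 1)) #<= bb_tree a u b1 b2 s.
Proof.
move=> n_gt0 k_ge0 uE; set N := `|(k %/ norm_infty p)%Z|%N.
rewrite -addnBA // addnC -card_partial_ord_partitions.
(* A sum of at most N bounds every letter by N, whence the type 'I_N.+1. *)
pose word (t : (n - 1).-tuple 'I_N.+1) := map val t.
apply: (@branch_nodes_card_ge _ _ word) => [t t' e|t _|t].
- by apply: val_inj; apply: (inj_map val_inj).
- by rewrite size_map size_tuple leq_subr.
rewrite inE => tN.
have word_size : size (word t) = (n - 1)%N by rewrite size_map size_tuple.
have word_le : (size (word t) <= n)%N by rewrite word_size leq_subr.
(* The last variable takes the value k + 1, which alone gives p y >= k + 1. *)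
apply: (@branch_node_completion_reached `|k|.+1) => //.
- by move=> i; rewrite uE !mxE /= leey ler0n.
- apply: le_trans (dot_completion0_le word_le) _.
  have norm_gt0 : 0 < norm_infty p.
    exact: lt_le_trans (p_gt0 (Ordinal n_gt0)) (le_norm_infty _).
  rewrite ler_int mulrC -lez_divRL //.
  rewrite -[leRHS]gez0_abs ?divz_ge0 // lez_nat (leq_trans _ tN) //.
  by rewrite sumnE big_map.
have ltn1n : (n - 1 < n)%N by rewrite subn1 prednK.
apply: le_trans (dot_completion_ge (i := s (Ordinal ltn1n)) _ _).
  by rewrite pmulrn ler_int -addn1 PoszD gez0_abs.
by rewrite permK word_size.
Qed.

End Knapsack.

Theorem theorem3 (R : realType) (n : nat)
    (a : 'rV[int]_n) (u : 'rV[\bar int]_n) (b1 b2 : R)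
    (p : 'rV[int]_n) (k : int)
    (ha : forall i, 0 < a 0 i)
    (hu : forall i, (0 < u 0%R i)%E)
    (hb1 : 0 < b1) (hb12 : b1 <= b2) (hb2 : (b2%:E < toR R (edot a u))%E)
    (hp : forall i, 0 < p 0 i)
    (hk : infeasibility_proven_by (kp_lp a u b1 b2) p k) :
  (u = const_mx 1%:E ->
     forall s : 'S_n, `I_(2 ^ ell p k) #<= bb_tree a u b1 b2 s) /\
  (u = const_mx +oo%E ->
     forall s : 'S_n,
       `I_('C(`|(k %/ norm_infty p)%Z| + n - 1, n - 1)) #<= bb_tree a u b1 b2 s).
Proof.
split=> uE s; first exact: (binary_nodes_card_ge ha hp hb1 hb12 hb2 hk).
have n_gt0 : (0 < n)%N.
  case: posnP => // n0; have := hb2; rewrite /edot big1 => [|i _].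
    by rewrite lte_fin ltNge (le_trans (ltW hb1)).
  by have := ltn_ord i; rewrite {2}n0.
have k_ge0 := split_index_ge0 ha hp hb1 hb12 hb2 hk hu.
exact: (unbounded_nodes_card_ge ha hp hb1 hb12 hb2 hk).
Qed.
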